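(* Let $X$ be one of the following surfaces: the Euclidean plane $\mathbb{E}^2$, the round sphere $\mathbb{S}^2$ of some radius $r>0$, or the hyperbolic plane $\mathbb{H}^2$ of constant curvature $-1/r^2$ for some $r>0$. Let $ABDC$ be an equiangular quadrilateral in $X$. For a point $A$ and a distance $\rho$, let $O(A,\rho)$ denote the disk in $X$ with center $A$ and radius $\rho$, and let $O_{AB}=O(A,|AB|)$, $O_{AC}=O(A,|AC|)$, $O_{AD}=O(A,|AD|)$, where $|PQ|$ denotes the (intrinsic) distance in $X$ between $P$ and $Q$. Then \[ \operatorname{area}(O_{AB})+\operatorname{area}(O_{AC})=\operatorname{area}(O_{AD}). \]
   Context: Straight lines in $\mathbb{S}^2$ are great circles, and segments (arcs) between two non-antipodal points are the shortest great-circle arcs joining them; in $\mathbb{H}^2$ they are geodesics. A quadrilateral $ABDC$ has vertices in cyclic order $A,B,D,C$, sides the segments $AB$, $BD$, $DC$, $CA$, and diagonals $AD$ and $BC$. It is called equiangular if its four interior angles are all equal; equivalently, the diagonals $AD$ and $BC$ have equal length and intersect each other in their midpoints. A disk with center $A$ and radius $\rho$ is the set of points of $X$ at distance at most $\rho$ from $A$, and area is the Riemannian area on $X$. *)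

(* Defs.v *)
From HB Require Import structures.
From mathcomp Require Import all_boot all_order all_algebra.
From mathcomp Require Import all_classical all_reals all_analysis.
Set Implicit Arguments. Unset Strict Implicit. Unset Printing Implicit Defensive.
Import Order.TTheory GRing.Theory Num.Theory.
Local Open Scope classical_set_scope.
Local Open Scope ring_scope.

(* The three model surfaces, each realised inside R^3 (points (x,y,z)):
   - Euclid : the plane z = 0 with the Euclidean metric;
   - Sphere : the round sphere x^2+y^2+z^2 = r^2 with its intrinsic metric;
   - Hyper  : the upper sheet of the hyperboloid x^2+y^2-z^2 = -r^2, z > 0,
              with the Minkowski-induced metric (curvature -1/r^2). *)
Inductive model := Euclid | Sphere | Hyper.

Section Geometry.
Variable R : realType.
Definition pt := (R * R * R)%type.
Definition px (p : pt) : R := p.1.1.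
Definition py (p : pt) : R := p.1.2.
Definition pz (p : pt) : R := p.2.

Definition sinh (t : R) : R := (expR t - expR (- t)) / 2.
Definition cosh (t : R) : R := (expR t + expR (- t)) / 2.
Definition acosh (x : R) : R := ln (x + Num.sqrt (x ^+ 2 - 1)).

Definition onX (k : model) (r : R) (p : pt) : Prop :=
  match k with
  | Euclid => pz p = 0
  | Sphere => px p ^+ 2 + py p ^+ 2 + pz p ^+ 2 = r ^+ 2
  | Hyper => px p ^+ 2 + py p ^+ 2 - pz p ^+ 2 = - r ^+ 2 /\ 0 < pz p
  end.

Definition distX (k : model) (r : R) (p q : pt) : R :=
  match k with
  | Euclid => Num.sqrt ((px p - px q) ^+ 2 + (py p - py q) ^+ 2 + (pz p - pz q) ^+ 2)
  | Sphere => r * acos ((px p * px q + py p * py q + pz p * pz q) / r ^+ 2)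
  | Hyper => r * acosh ((pz p * pz q - px p * px q - py p * py q) / r ^+ 2)
  end.

Definition disk (k : model) (r : R) (A : pt) (rho : R) : set pt :=
  [set P | onX k r P /\ distX k r A P <= rho].

(* Parametrisation (a.e. injective, onto X) and Riemannian area density *)
Definition param (k : model) (r : R) (u : R * R) : pt :=
  match k with
  | Euclid => (u.1, u.2, 0)
  | Sphere => (r * sin u.1 * cos u.2, r * sin u.1 * sin u.2, r * cos u.1)
  | Hyper => (r * sinh u.1 * cos u.2, r * sinh u.1 * sin u.2, r * cosh u.1)
  end.

Definition pdom (k : model) : set (R * R) :=
  match k with
  | Euclid => setT
  | Sphere => `[0, pi]%classic `*` `[0, 2 * pi[%classic
  | Hyper => `[0, +oo[%classic `*` `[0, 2 * pi[%classic
  end.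

Definition dens (k : model) (r : R) (u : R * R) : R :=
  match k with
  | Euclid => 1
  | Sphere => r ^+ 2 * sin u.1
  | Hyper => r ^+ 2 * sinh u.1
  end.

Definition areaX (k : model) (r : R) (S : set pt) : \bar R :=
  (\int[(@lebesgue_measure R) \x (@lebesgue_measure R)]_(u in pdom k)
     ((if `[< S (param k r u) >] then dens k r u else 0)%:E))%E.

(* a segment between P and Q is defined (P, Q not antipodal on the sphere) *)
Definition seg_ok (k : model) (r : R) (P Q : pt) : Prop :=
  match k with
  | Sphere => distX k r P Q < pi * r
  | _ => True
  end.

(* ABDC (cyclic order A,B,D,C) is an equiangular quadrilateral in X:
   four distinct vertices on X, all sides and diagonals are segments, and the
   diagonals AD and BC have equal length and meet at their common midpoint. *)
Definition equiangular_quad (k : model) (r : R) (A B D C : pt) : Prop :=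
  [/\ onX k r A, onX k r B, onX k r D & onX k r C] /\
  [/\ A <> B, A <> D, A <> C & B <> D] /\ (B <> C /\ D <> C) /\
  [/\ seg_ok k r A B, seg_ok k r B D, seg_ok k r D C & seg_ok k r C A] /\
  (seg_ok k r A D /\ seg_ok k r B C) /\
  distX k r A D = distX k r B C /\
  exists M : pt, [/\ onX k r M,
      distX k r A M = distX k r A D / 2, distX k r M D = distX k r A D / 2,
      distX k r B M = distX k r B C / 2 & distX k r M C = distX k r B C / 2].

End Geometry.

(* Main.v *)
Require Import Defs.
From HB Require Import structures.
From mathcomp Require Import all_boot all_order all_algebra.
From mathcomp Require Import all_classical all_reals all_analysis.
From mathcomp Require Import measurable_realfun.
From mathcomp Require Import ring lra.

(* On the sphere and on the hyperbolic plane the disk of radius [rho] has area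
   [2 pi (r^2 - A.P)], resp. [2 pi (A.P - r^2)], for any [P] at distance [rho] from [A], where
   [.] is the ambient Euclidean, resp. Minkowski, product: it is affine in [A.P].  The common
   midpoint [M] of the diagonals satisfies [A + D = 2 k M = B + C] in the ambient space,
   with [k] the (hyperbolic) cosine of half a diagonal, whence
   [A.B + A.C = A.A + A.D] and the areas add up.  In the plane the area is a constant
   multiple of [rho^2] and the quadrilateral is a rectangle.

   In polar coordinates around the fixed pole, with [z = cos theta] or [cosh theta],
   the area of a disk with an arbitrary center is the integral over [(z, phi)] of a function
   of [t = c z + sqrt ((1 - c^2) (1 - z^2)) cos phi].  Replacing [phi] by [t] introduces
   a weight that is symmetric in [z] and [t], and Tonelli's theorem does the rest. *)

Set Implicit Arguments.
Unset Strict Implicit.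
Unset Printing Implicit Defensive.
Import Order.TTheory GRing.Theory Num.Theory.
Import numFieldNormedType.Exports.
Local Open Scope classical_set_scope.
Local Open Scope ring_scope.

(** * Change of variables through image measures *)

Section density_image.
Context {R : realType}.
Notation leb := (@lebesgue_measure R).
Local Open Scope ereal_scope.

(** A sigma type hands out the restriction as an opaque bundled measure known only through its
    values, the form in which [ge0_integral_restr] takes it. *)
Lemma restricted_measure d (T : measurableType d) (mu : {measure set T -> \bar R})
    (D : set T) : measurable D ->
  {nu : {measure set T -> \bar R} | forall A, measurable A -> nu A = mu (A `&` D)}.
Proof. by move=> mD; exists [the measure _ _ of mrestr mu mD]. Qed.

(** Split the space into [D] and its complement: [nu] agrees with [mu] inside [D] and is the zero
    measure outside. *)
Lemma ge0_integral_restr d (T : measurableType d)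
    (mu nu : {measure set T -> \bar R}) (D : set T) (f : T -> \bar R) :
  measurable D -> (forall A, measurable A -> nu A = mu (A `&` D)) ->
  measurable_fun setT f -> (forall x, 0 <= f x) ->
  \int[nu]_x f x = \int[mu]_(x in D) f x.
Proof.
move=> mD nuE mf f0; rewrite -(setUv D) ge0_integral_setU//=; last 3 first.
- exact: measurableC.
- by rewrite setUv.
- exact/disj_set2P/setICr.
rewrite (eq_measure_integral mu); last first.
  by move=> A mA AD; rewrite nuE// setIidl.
rewrite [X in _ + X](eq_measure_integral mzero); last first.
  move=> A mA AD; rewrite nuE// [X in mu X](_ : _ = set0) ?measure0//.
  by apply/seteqP; split => // x [] /AD.
by rewrite integral_measure_zero adde0.
Qed.

(* A weight [w] on [I] is realised by Lebesgue measure on its subgraph, so that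
   pushing the subgraph forward along [F \o fst] gives the image measure. *)
Lemma ge0_image_density (I J : set R) (F w : R -> R) :
  measurable I -> measurable J -> measurable_fun setT F -> measurable_fun setT w ->
  (forall x, I x -> (0 <= w x)%R) ->
  (forall y, \int[leb]_(x in I `&` F @^-1` `]-oo, y[) (w x)%:E =
     leb (J `&` `]-oo, y[)) ->
  (forall y, leb (J `&` `]-oo, y[) < +oo) ->
  forall g : R -> \bar R, measurable_fun setT g -> (forall x, 0 <= g x) ->
  \int[leb]_(x in I) (g (F x) * (w x)%:E) = \int[leb]_(x in J) g x.
Proof.
move=> mI mJ mF mw w0 rays fin.
pose S := [set u : R * R | I u.1 /\ (0 <= u.2 < w u.1)%R].
have mS : measurable S.
  have -> : S = (I `*` setT) `&` ((setT `*` `[0%R, +oo[) `&`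
      [set u | (w u.1 - u.2)%R \in `]0%R, +oo[]).
    apply/seteqP; split => [[x s]|[x s]] /=;
      rewrite !in_itv/= !andbT subr_gt0.
    by move=> [Ix /andP[s0 sw]].
    by move=> [[Ix _] [[_ s0] sw]]; split => //; apply/andP.
  apply: measurableI; first exact: measurableX.
  apply: measurableI; first exact: measurableX.
  have : measurable_fun setT (fun u : R * R => (w u.1 - u.2)%R).
    by apply: measurable_funB => //; exact: measurableT_comp.
  by move=> /(_ measurableT `]0%R, +oo[%classic (measurable_itv _)); rewrite setTI.
have mFf : measurable_fun setT (F \o (fst : R * R -> R)) by exact: measurableT_comp.
have [lebS lebSE] := restricted_measure (leb \x leb) mS.
have [lebJ lebJE] := restricted_measure leb mJ.
pose Ff : R * R -> measurableTypeR R := F \o fst.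
pose m0 : {measure set (measurableTypeR R) -> \bar R} := pushforward lebS Ff.
pose m1 : {measure set (measurableTypeR R) -> \bar R} := m0 mFf.
have mgw (g : R -> \bar R) : measurable_fun setT g ->
    measurable_fun setT (fun x : R => (g (F x) * (w x)%:E)).
  move=> mg; apply: emeasurable_funM; first exact: measurableT_comp.
  exact/measurable_EFinP.
(* By Tonelli the section of [S] above [x] in [I] is [[0, w x[], of length [w x], and the integrand
   is constant on it. *)
have key (g : R -> \bar R) : measurable_fun setT g -> (forall x, 0 <= g x) ->
    \int[m1]_x g x = \int[leb]_(x in I) (g (F x) * (w x)%:E).
  move=> mg g0.
  rewrite /m1 ge0_integral_pushforward//=.
  rewrite preimage_setT (@ge0_integral_restr _ _ (leb \x leb) _ S)//; last exact: measurableT_comp.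
  rewrite integral_mkcond fubini_tonelli1/=; last 2 first.
  - apply/(measurable_restrictT _ _).1 => //.
    by apply: measurable_funTS; exact: measurableT_comp.
  - by move=> u; apply: erestrict_ge0.
  rewrite [RHS]integral_mkcond; apply: eq_integral => x _.
  rewrite /fubini_F !patchE; case: ifPn => [|/negP xI].
    rewrite inE => Ix.
    transitivity (\int[leb]_(s in `[0%R, w x[) g (F x)).
      rewrite [RHS]integral_mkcond; apply: eq_integral => s _.
      rewrite !patchE/=; congr (if _ then _ else _).
      apply/idP/idP; rewrite !inE /S /= in_itv/=; first by case.
      by split.
    rewrite integral_cst//= lebesgue_measure_itv/= lte_fin.
    by case: ltP => [_|]; [rewrite oppr0 adde0|have := w0 _ Ix => ? ?; rewrite (_ : w x = 0%R)//; apply/eqP; rewrite eq_le; apply/andP].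
  under eq_integral => s _.
    rewrite patchE memNset; last by move=> []/mem_set.
    over.
  by rewrite integral0.
(* The rays []-oo, y[] form a generating class closed under intersection. The two measures agree and
   are finite on them, and countably many of them cover the line, so the measures coincide. *)
have m1E A : measurable A -> m1 A = leb (J `&` A).
  move=> mA; rewrite setIC -lebJE//.
  have seqE : \bigcup_k `]-oo, k%:R[%classic = [set: R].
    rewrite -subTset => x _; exists (Num.truncn x).+1 => //=.
    by rewrite in_itv/= truncnS_gt.
  have rayE y : m1 `]-oo, y[%classic = lebJ `]-oo, y[%classic.
    transitivity (leb (J `&` `]-oo, y[)); last by rewrite lebJE// setIC.
    rewrite -rays -[X in m1 X]setIT -integral_indic// key//; last first.
      exact/measurable_EFinP.
    rewrite integral_mkcond [RHS]integral_mkcond; apply: eq_integral => x _.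
    rewrite !patchE indicE in_setI.
    have -> : (x \in F @^-1` `]-oo, y[%classic) = (F x \in `]-oo, y[%classic).
      by apply/idP/idP; rewrite !inE.
    case: (x \in I); case: (F x \in _) => //=; [exact: mul1e|exact: mul0e].
  apply: (@measure_unique _ R (measurableTypeR R) (@RGenInftyO.G R) (fun k => `]-oo, k%:R[%classic) _ _ _ _ m1 lebJ _ _) => //.
  - exact: RGenInftyO.measurableE.
  - move=> _ _ [x ->] [y ->]; exists (Num.min x y).
    by apply/seteqP; split => z /=; rewrite !in_itv/= lt_min => /andP.
  - by move=> i; exists i%:R.
  - by move=> _ [y ->]; exact: rayE.
  - by move=> k; rewrite rayE lebJE// setIC; exact: fin.
move=> g mg g0; rewrite -key//.
rewrite (eq_measure_integral lebJ); last by move=> A mA _; rewrite m1E// lebJE// setIC.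
exact: ge0_integral_restr.
Qed.
End density_image.

(** * Hyperbolic sine and cosine *)

Section hyperbolic_functions.
Context {R : realType}.
Implicit Types x y : R.

Lemma cosh2_sinh2 x : cosh x ^+ 2 - sinh x ^+ 2 = 1.
Proof.
have := expRxMexpNx_1 x; rewrite /cosh /sinh => h.
transitivity (expR x * expR (- x)); last exact: h.
by field.
Qed.

Lemma cosh_sinhD x : cosh x + sinh x = expR x.
Proof. by rewrite /cosh /sinh; field. Qed.

Lemma sinh_ge0 x : 0 <= x -> 0 <= sinh x.
Proof.
move=> x0; rewrite /sinh divr_ge0// subr_ge0 ler_expR.
by rewrite (le_trans _ x0)// oppr_le0.
Qed.

(** The difference factors as [cosh y - cosh x = (e^y - e^x) (1 - e^(-(x + y))) / 2], and both
    factors are positive for [0 <= x < y]. *)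
Lemma ler_cosh : {in `[0, +oo[ &, {mono (@cosh R) : x y / x <= y}}.
Proof.
apply: le_mono_in => x y; rewrite !in_itv/= !andbT => x0 y0 xy.
have -> : cosh x = cosh y - (expR y - expR x) * (1 - expR (- (x + y))) / 2.
  rewrite /cosh opprD expRD.
  have := expRxMexpNx_1 x; have := expRxMexpNx_1 y.
  move: (expR x) (expR y) (expR (- x)) (expR (- y)) => a b a' b' hb ha.
  have -> : (b - a) * (1 - a' * b') = b - a - (b * b') * a' + (a * a') * b' by ring.
  by rewrite ha hb; field.
rewrite gtrBl divr_gt0// mulr_gt0// subr_gt0 ?ltr_expR// -expR0 ltr_expR.
by rewrite oppr_lt0 ltr_wpDl// (le_lt_trans x0).
Qed.

Lemma cosh0 : cosh (0 : R) = 1.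
Proof. by rewrite /cosh oppr0 expR0; field. Qed.

Lemma cosh_ge1 x : 0 <= x -> 1 <= cosh x.
Proof. by move=> x0; rewrite -cosh0 ler_cosh// in_itv/= ?lexx ?andbT. Qed.

Lemma acoshK x : 1 <= x -> cosh (acosh x) = x.
Proof.
move=> x1; have x0 : 0 < x by lra.
have x21 : 0 <= x ^+ 2 - 1 by nra.
have u0 : 0 < x + Num.sqrt (x ^+ 2 - 1) by rewrite ltr_pwDl// sqrtr_ge0.
rewrite /cosh /acosh expRN lnK ?posrE//.
have := sqr_sqrtr x21; have := sqrtr_ge0 (x ^+ 2 - 1).
move: (Num.sqrt _) u0 => s u0 s0 s2.
(* Indeed [(x + s) (x - s) = x^2 - s^2 = 1]. *)
have -> : (x + s)^-1 = x - s.
  by apply: (mulfI (lt0r_neq0 u0)); rewrite divff ?lt0r_neq0// mulrC -subr_sqr s2; ring.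
by field.
Qed.

Lemma acosh_ge0 x : 1 <= x -> 0 <= acosh x.
Proof.
move=> x1; rewrite ln_ge0//.
by rewrite (le_trans x1)// lerDl sqrtr_ge0.
Qed.

Lemma is_derive_cosh x : is_derive x 1 (@cosh R) (sinh x).
Proof.
have dN : is_derive x 1 (expR \o -%R) (- expR (- x)).
  have := @is_derive1_comp R expR -%R x (expR (- x)) (- 1) _ _.
  by rewrite mulrN1; apply.
have -> : @cosh R = 2^-1 \*: (expR + (expR \o -%R)).
  by apply/funext => y; exact: mulrC.
apply: is_derive_eq; exact: mulrC.
Qed.

Lemma continuous_sinh : continuous (@sinh R).
Proof.
move=> x; apply: cvgM; last exact: cvg_cst.
apply: cvgB; first exact: continuous_expR.
apply: (@continuous_comp _ _ _ -%R expR); last exact: continuous_expR.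
exact: opp_continuous.
Qed.

Lemma continuous_cosh : continuous (@cosh R).
Proof.
move=> x; apply: differentiable_continuous; apply/derivable1_diffP.
exact: (@ex_derive _ _ _ _ _ _ _ (is_derive_cosh x)).
Qed.

End hyperbolic_functions.

(** * The substitutions by [cosh] and by [a + b cos] *)

Section substitutions.
Context {R : realType}.
Notation leb := (@lebesgue_measure R).

(** A derivative known on the whole line leaves no one-sided conditions at the ends, and the
    degenerate interval is allowed. *)
Lemma continuous_FTC2_derive (f F : R -> R) (a b : R) : a <= b ->
  (forall x : R, is_derive x 1 F (f x)) -> continuous f ->
  (\int[leb]_(x in `[a, b]) (f x)%:E = (F b - F a)%:E)%E.
Proof.
rewrite le_eqVlt => /predU1P[->|ab] dF cf.
  by rewrite set_itv1 integral_set1 subrr.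
have cF : continuous F.
  move=> x; apply: differentiable_continuous; apply/derivable1_diffP.
  exact: (@ex_derive _ _ _ _ _ _ _ (dF x)).
rewrite (@continuous_FTC2 _ f F)//.
- exact: continuous_subspaceT.
- split; [by move=> x _; exact: (@ex_derive _ _ _ _ _ _ _ (dF x))| |].
  + exact/cvg_at_right_filter/cF.
  + exact/cvg_at_left_filter/cF.
- by move=> x _; rewrite derive1E derive_val.
Qed.

Lemma continuous_measurable_EFin (f : R -> R) (D : set R) : continuous f ->
  measurable_fun D (fun x => (f x)%:E).
Proof.
move=> cf; apply/measurable_EFinP; apply: measurable_funTS.
exact: continuous_measurable_fun.
Qed.

(** By [ge0_image_density] only rays need checking: for [y > 1] the preimage of []-oo, y[] is [[0,
    acosh y[], on which [sinh] has integral [y - 1]. *)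
Lemma ge0_integral_cosh (g : R -> \bar R) :
  measurable_fun setT g -> (forall x, 0 <= g x)%E ->
  (\int[leb]_(x in `[0%R, +oo[) (g (cosh x) * (sinh x)%:E) =
   \int[leb]_(z in `[1%R, +oo[) g z)%E.
Proof.
have rayR y : `[1, +oo[ `&` `]-oo, y[ = `[1, y[%classic :> set R.
  by apply/seteqP; split => x /=; rewrite !in_itv/= ?andbT => /andP.
move=> mg g0; apply: ge0_image_density => //.
- by apply: continuous_measurable_fun; exact: continuous_cosh.
- by apply: continuous_measurable_fun; exact: continuous_sinh.
- by move=> x; rewrite /= in_itv/= andbT; exact: sinh_ge0.
- move=> y; rewrite rayR; have [y1|y1] := leP y 1.
    rewrite [X in leb X](_ : _ = set0) ?measure0; last first.
      by apply/seteqP; split => x//=; rewrite in_itv/=; lra.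
    rewrite [X in integral _ X](_ : _ = set0) ?integral_set0//.
    apply/seteqP; split => x//=; rewrite !in_itv/= andbT => -[x0].
    by rewrite ltNge (le_trans y1)// cosh_ge1.
  rewrite [X in integral _ X](_ : _ = `[0, acosh y[%classic); last first.
    apply/seteqP; split => x /=; rewrite !in_itv/= ?andbT.
      move=> [x0 xy]; rewrite x0/= -(leW_mono_in ler_cosh) ?in_itv/= ?andbT//.
        by rewrite acoshK// ltW.
      by rewrite acosh_ge0// ltW.
    move=> /andP[x0]; rewrite -(leW_mono_in ler_cosh) ?in_itv/= ?andbT//.
      by rewrite acoshK// ltW.
    by rewrite acosh_ge0// ltW.
  rewrite integral_itv_bndo_bndc; last exact: (continuous_measurable_EFin continuous_sinh).
  apply: (etrans (continuous_FTC2_derive (acosh_ge0 (ltW y1))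
    is_derive_cosh continuous_sinh)).
  rewrite acoshK ?(ltW y1)// cosh0 lebesgue_measure_itv/= lte_fin y1.
  by rewrite EFinB.
- by move=> y; rewrite rayR lebesgue_measure_itv/=; case: ifP => _; rewrite -?EFinB ltry.
Qed.

(** Again only rays matter. The map decreases, so the preimage of []-oo, y[] is an interval ending
    at [pi]: empty for [y <= a - b], all of [[0, pi]] for [y > a + b], and starting at
    [acos ((y - a) / b)] in between. *)
Lemma ge0_integral_affine_cos (a b : R) (g : R -> \bar R) : 0 < b ->
  measurable_fun setT g -> (forall x, 0 <= g x)%E ->
  (\int[leb]_(x in `[0%R, pi]) (g (a + b * cos x)%R * (b * sin x)%:E) =
   \int[leb]_(z in `[(a - b)%R, (a + b)%R]) g z)%E.
Proof.
move=> b0 mg g0.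
have cF : continuous (fun x : R => a + b * cos x).
  move=> x; apply: cvgD; first exact: cvg_cst.
  by apply: cvgM; [exact: cvg_cst|exact: continuous_cos].
have cw : continuous (fun x : R => b * sin x).
  by move=> x; apply: cvgM; [exact: cvg_cst|exact: continuous_sin].
have dF (x : R) : is_derive x 1 (fun x : R => - (b * cos x)) (b * sin x).
  have -> : (fun x : R => - (b * cos x)) = - b \*: cos.
    by apply/funext => y; exact: esym (mulNr _ _).
  by apply: is_derive_eq; exact: mulrNN.
have Iab (c d : R) : c <= d -> (\int[leb]_(x in `[c, d]) (b * sin x)%:E =
    (b * cos c - b * cos d)%:E)%E.
  by move=> cd; rewrite (continuous_FTC2_derive cd dF cw); congr (_%:E); ring.
apply: ge0_image_density => //.
- exact: continuous_measurable_fun.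
- exact: continuous_measurable_fun.
- by move=> x; rewrite /= in_itv/= => /sin_ge0_pi s0; rewrite mulr_ge0// ltW.
- move=> y; have [ya|ya] := leP y (a - b).
    rewrite [X in integral _ X](_ : _ = set0) ?integral_set0; last first.
      apply/seteqP; split => x//=; rewrite !in_itv/= => -[_].
      have := cos_geN1 x; nra.
    rewrite [X in leb X](_ : _ = set0) ?measure0//.
    by apply/seteqP; split => x//=; rewrite !in_itv/= => -[]; lra.
  have [yb|yb] := ltP (a + b) y.
    rewrite [X in integral _ X](_ : _ = `[0, pi]%classic); last first.
      apply/seteqP; split => x/=; rewrite !in_itv/=; first by case.
      by move=> ->; split => //; have := cos_le1 x; nra.
    rewrite [X in leb X](_ : _ = `[a - b, a + b]%classic); last first.
      by apply/seteqP; split => x/=; rewrite !in_itv/=; lra.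
    rewrite Iab ?pi_ge0// cos0 cospi lebesgue_measure_itv/= lte_fin.
    by rewrite ifT; [rewrite -EFinB; congr (_%:E); ring|lra].
  have u1 : -1 < (y - a) / b <= 1.
    by rewrite ltr_pdivlMr// ler_pdivrMr//; lra.
  have u1' : -1 <= (y - a) / b <= 1 by case/andP: u1 => /ltW -> ->.
  have t0 := acos_ge0 u1'; have tpi := acos_ltpi u1.
  rewrite [X in integral _ X](_ : _ = `]acos ((y - a) / b), pi]%classic); last first.
    have E x : x \in `[0, pi] -> (a + b * cos x < y) = (acos ((y - a) / b) < x).
      move=> x0; rewrite -ltr_cos ?in_itv/= ?t0 ?(ltW tpi)// acosK ?in_itv//=.
      by rewrite ltr_pdivlMr// ltrBrDl (mulrC (cos x)).
    apply/seteqP; split => x /=; rewrite [in X in X -> _]in_itv/=.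
      by rewrite [in X in _ /\ X]in_itv/= => -[x0]; rewrite E// in_itv/= => ->; case/andP: x0.
    move=> /andP[tx xpi]; have x0 : x \in `[0, pi] by rewrite in_itv/= xpi (le_trans t0)// ltW.
    by split => //; rewrite in_itv/= E.
  rewrite integral_itv_obnd_cbnd; last exact: (continuous_measurable_EFin cw).
  rewrite Iab ?ltW// acosK ?in_itv//= cospi.
  rewrite [X in leb X](_ : _ = `[a - b, y[%classic); last first.
    apply/seteqP; split => x/=; rewrite !in_itv/=; first by move=> [/andP[-> _]].
    by move=> /andP[-> xy]/=; rewrite xy (ltW (lt_le_trans xy yb)).
  rewrite lebesgue_measure_itv/= lte_fin ya -EFinB; congr (_%:E).
  by rewrite mulrC divfK ?gt_eqF//; ring.
- move=> y; apply: (@le_lt_trans _ _ (leb `[a - b, a + b])).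
    apply: le_measure => //; rewrite inE//=.
    exact: measurableI.
  by rewrite lebesgue_measure_itv/=; case: ifP => _; rewrite -?EFinB ltry.
Qed.

End substitutions.

(** * Tonelli on rectangles and averages over circles of latitude *)

Section mean_over_circles.
Context {R : realType}.
Notation leb := (@lebesgue_measure R).
Implicit Types (A B Z : set R).

Lemma ge0_integral_setX A B (f : R * R -> \bar R) :
  measurable A -> measurable B -> measurable_fun setT f -> (forall u, 0 <= f u)%E ->
  (\int[leb \x leb]_(u in A `*` B) f u =
   \int[leb]_(x in A) \int[leb]_(y in B) f (x, y))%E.
Proof.
move=> mA mB mf f0; rewrite integral_mkcond fubini_tonelli1/=; last 2 first.
- apply/(measurable_restrictT _ _).1; first exact: measurableX.
  exact: measurable_funTS.
- by move=> u; apply: erestrict_ge0.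
rewrite [RHS]integral_mkcond; apply: eq_integral => x _.
rewrite /fubini_F patchE; case: ifPn => xA.
  rewrite [RHS]integral_mkcond; apply: eq_integral => y _.
  by rewrite !patchE in_setX/= xA.
under eq_integral => y _ do rewrite patchE in_setX/= (negbTE xA)/=.
by rewrite integral0.
Qed.

Lemma ge0_exchange_integral A B (f : R * R -> \bar R) :
  measurable A -> measurable B -> measurable_fun setT f -> (forall u, 0 <= f u)%E ->
  (\int[leb]_(x in A) \int[leb]_(y in B) f (x, y) =
   \int[leb]_(y in B) \int[leb]_(x in A) f (x, y))%E.
Proof.
move=> mA mB mf f0; rewrite -ge0_integral_setX//.
rewrite integral_mkcond fubini_tonelli2/=; last 2 first.
- apply/(measurable_restrictT _ _).1; first exact: measurableX.
  exact: measurable_funTS.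
- by move=> u; apply: erestrict_ge0.
rewrite [RHS]integral_mkcond; apply: eq_integral => y _.
rewrite /fubini_G patchE; case: ifPn => yB.
  rewrite [RHS]integral_mkcond; apply: eq_integral => x _.
  by rewrite !patchE in_setX/= yB andbT.
under eq_integral => x _ do rewrite patchE in_setX/= (negbTE yB) andbF/=.
by rewrite integral0.
Qed.

(** Inversion is continuous on the open set of nonzero reals, and the single point [0] is
    harmless. *)
Lemma measurable_fun_inv : measurable_fun setT (@GRing.inv R).
Proof.
rewrite -(setvU [set 0]); apply/measurable_funU; rewrite ?setCK//.
  exact: measurableC.
split; last exact: measurable_fun_set1.
apply: open_continuous_measurable_fun; first by rewrite openC; exact: closed_eq.
by move=> x; rewrite inE/= => /eqP; exact: inv_continuous.
Qed.

(* For [t = a + b cos x] one has [b sin x = sqrt (b ^ 2 - (t - a) ^ 2)]; outside of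
   [|t - a| < b] the weight below is [0] since [sqrt] vanishes there and [0^-1 = 0]. *)
Lemma ge0_integral_arcsine Z (a b : R) (g : R -> \bar R) : 0 < b -> measurable Z ->
  (forall t, 0 < b ^+ 2 - (t - a) ^+ 2 -> Z t) ->
  measurable_fun setT g -> (forall x, 0 <= g x)%E ->
  (\int[leb]_(x in `[0%R, pi]) g (a + b * cos x)%R =
   \int[leb]_(t in Z) (g t * ((Num.sqrt (b ^+ 2 - (t - a) ^+ 2))^-1)%:E))%E.
Proof.
move=> b0 mZ Zab mg g0.
pose k (t : R) : R := (Num.sqrt (b ^+ 2 - (t - a) ^+ 2))^-1.
have mk : measurable_fun setT k.
  apply: (measurableT_comp measurable_fun_inv).
  apply: continuous_measurable_fun => t.
  apply: (@continuous_comp _ _ _ (fun t => b ^+ 2 - (t - a) ^+ 2)); last exact: sqrt_continuous.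
  apply: cvgB; first exact: cvg_cst.
  by apply: (@cvgM _ _ _ _ (fun t => t - a) (fun t => t - a)); apply: cvgB => //; exact: cvg_cst.
have k0 t : 0 <= k t by rewrite invr_ge0 sqrtr_ge0.
have mgk : measurable_fun setT (fun t => (g t * (k t)%:E)%E).
  by apply: emeasurable_funM => //; exact/measurable_EFinP.
have mF : measurable_fun setT (fun x : R => a + b * cos x).
  apply: continuous_measurable_fun => x; apply: cvgD; first exact: cvg_cst.
  by apply: cvgM; [exact: cvg_cst|exact: continuous_cos].
(* On the open interval [sin x > 0], so the inserted product [k (a + b cos x) * (b sin x)] equals
   [1]; the two endpoints form a null set. *)
transitivity (\int[leb]_(x in `[0%R, pi])
    (g (a + b * cos x)%R * (k (a + b * cos x)%R)%:E * (b * sin x)%:E))%E.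
  rewrite integral_itv_bndoo; last first.
    by apply: measurable_funTS; exact: (measurableT_comp mg mF).
  rewrite [RHS]integral_itv_bndoo; last first.
    apply: measurable_funTS; apply: emeasurable_funM.
      exact: (measurableT_comp mgk mF).
    by apply: continuous_measurable_EFin => x; apply: cvgM; [exact: cvg_cst|exact: continuous_sin].
  apply: eq_integral => x; rewrite inE/= in_itv/= => /sin_gt0_pi s0.
  rewrite -muleA -EFinM /k (_ : b ^+ 2 - _ = (b * sin x) ^+ 2); last first.
    by rewrite exprMn sin2cos2; ring.
  by rewrite sqrtr_sqr gtr0_norm ?mulVf ?mule1// ?gt_eqF// mulr_gt0.
rewrite (ge0_integral_affine_cos a b0 mgk); last by move=> x; rewrite mule_ge0// lee_fin.
rewrite integral_mkcond [RHS]integral_mkcond; apply: eq_integral => t _.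
have [tab|] := boolP (0 < b ^+ 2 - (t - a) ^+ 2).
  rewrite !patchE !mem_set//; first exact: Zab.
  by rewrite /= in_itv/=; nra.
rewrite -leNgt => tab; have kt : k t = 0 by rewrite /k ler0_sqrtr// invr0.
by rewrite !patchE -/(k t) kt mule0; do 2 case: ifP.
Qed.

(** The radicand is the Gram determinant of three unit vectors with mutual products [c], [z], [t].
    It equals [(1 - c^2) (1 - z^2) - (t - c z)^2], expanded here to show the symmetry in the three
    variables. *)
Definition cap_kernel (c z t : R) : R :=
  (Num.sqrt (1 - c ^+ 2 - z ^+ 2 - t ^+ 2 + 2 * c * z * t))^-1.

(* Averaging a zonal function over all circles of latitude.  With [b^2 = (1 - c^2)(1 - z^2)]
   and [t = c z + b cos x] the weight [1 / (b sin x)] is symmetric in [z] and [t], so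
   that after Tonelli the inner integral is that of the constant [1]. *)
Lemma ge0_integral_latitudes Z (c : R) (f : R -> \bar R) : measurable Z ->
  (forall z, Z z -> 0 < (1 - c ^+ 2) * (1 - z ^+ 2)) ->
  (forall z t, Z z -> 0 < (1 - c ^+ 2) * (1 - z ^+ 2) - (t - c * z) ^+ 2 -> Z t) ->
  measurable_fun setT f -> (forall x, 0 <= f x)%E ->
  (\int[leb]_(z in Z) \int[leb]_(x in `[0%R, pi])
     f (c * z + Num.sqrt ((1 - c ^+ 2) * (1 - z ^+ 2)) * cos x)%R =
   pi%:E * \int[leb]_(t in Z) f t)%E.
Proof.
move=> mZ Zpos Zt mf f0.
have arcsine z g : Z z -> measurable_fun setT g -> (forall x, 0 <= g x)%E ->
    (\int[leb]_(x in `[0%R, pi])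
       g (c * z + Num.sqrt ((1 - c ^+ 2) * (1 - z ^+ 2)) * cos x)%R =
     \int[leb]_(t in Z) (g t * (cap_kernel c z t)%:E))%E.
  move=> Zz mg g0; have p0 := Zpos _ Zz.
  have s2 := sqr_sqrtr (ltW p0).
  rewrite (@ge0_integral_arcsine Z) ?sqrtr_gt0//; last first.
    by move=> t; rewrite s2; exact: Zt.
  apply: eq_integral => t _; rewrite s2 /cap_kernel.
  by congr (_ * (Num.sqrt _)^-1%:E)%E; ring.
have mK : measurable_fun setT (fun u : R * R => (cap_kernel c u.1 u.2)).
  apply: (measurableT_comp measurable_fun_inv).
  have msqrt := continuous_measurable_fun (@sqrt_continuous R).
  apply: (measurableT_comp msqrt).
  apply: measurable_funD.
    apply: measurable_funB; last exact: measurable_funX.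
    by apply: measurable_funB => //; exact: measurable_funX.
  by apply: measurable_funM => //; apply: measurable_funM.
have K0 z t : 0 <= cap_kernel c z t by rewrite invr_ge0 sqrtr_ge0.
transitivity (\int[leb]_(z in Z) \int[leb]_(t in Z) (f t * (cap_kernel c z t)%:E))%E.
  by apply: eq_integral => z; rewrite inE => Zz; exact: arcsine.
rewrite (ge0_exchange_integral (f := fun u => (f u.2 * (cap_kernel c u.1 u.2)%:E)%E))//=; last 2 first.
- apply: emeasurable_funM; first exact: measurableT_comp.
  exact/measurable_EFinP.
- by move=> u; rewrite mule_ge0// lee_fin.
rewrite -ge0_integralZl//; last 2 first.
- exact: measurable_funTS.
- by rewrite lee_fin pi_ge0.
apply: eq_integral => t; rewrite inE => Zt0.
rewrite ge0_integralZl//; last 2 first.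
- apply/measurable_EFinP/measurable_funTS.
  exact: (measurableT_comp mK (measurable_pair2 t)).
- by move=> z _; rewrite lee_fin.
rewrite muleC; congr (_ * _)%E.
(* With [z] and [t] exchanged in the kernel, [arcsine] at height [t] for the constant [1] returns
   the length [pi] of [[0, pi]]. *)
transitivity (\int[leb]_(z in Z) (1 * (cap_kernel c t z)%:E))%E.
  apply: eq_integral => z _; rewrite mul1e /cap_kernel.
  by congr ((Num.sqrt _)^-1%:E); ring.
rewrite -(arcsine t (cst 1%E))// integral_cst//= lebesgue_measure_itv/= lte_fin pi_gt0.
by rewrite mul1e oppr0 adde0.
Qed.

End mean_over_circles.

(** * Rotation of the angle and integration in polar coordinates *)

Section polar_coordinates.
Context {R : realType}.
Notation leb := (@lebesgue_measure R).
Implicit Types (D I Z : set R) (g h : R -> \bar R).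

(** The image of Lebesgue measure under the translation gives each []a, b]] its length, hence is
    Lebesgue measure. *)
Lemma ge0_integral_shift D (d : R) g :
  measurable D -> measurable_fun setT g -> (forall x, 0 <= g x)%E ->
  (\int[leb]_(x in [set x | D (x + d)%R]) g (x + d)%R = \int[leb]_(x in D) g x)%E.
Proof.
move=> mD mg g0; pose F : measurableTypeR R -> measurableTypeR R := fun x => x + d.
have mF : measurable_fun setT F by exact: measurable_funD.
rewrite -[LHS](@ge0_integral_pushforward _ _ _ _ R F mF leb D g)//; last first.
  exact: measurable_funTS.
pose m0 : {measure set (measurableTypeR R) -> \bar R} := pushforward leb F.
apply: eq_measure_integral => //= A mA _.
apply/esym/(@lebesgue_measure_unique R (m0 mF)) => //= _ [[a b]] _ <-.
rewrite /pushforward [X in _ = leb X](_ : _ = `]a - d, b - d]%classic); last first.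
  by apply/seteqP; split => x /=; rewrite /F !in_itv/=; lra.
rewrite !lebesgue_measure_itv/= !lte_fin ltrD2; case: ifP => // _.
by rewrite -!EFinB; congr (_%:E); ring.
Qed.

Lemma ge0_integral_reflect D (d : R) g :
  measurable D -> measurable_fun setT g -> (forall x, 0 <= g x)%E ->
  (\int[leb]_(x in [set x | D (d - x)%R]) g (d - x)%R = \int[leb]_(x in D) g x)%E.
Proof.
move=> mD mg g0; pose F : measurableTypeR R -> measurableTypeR R := fun x => d - x.
have mF : measurable_fun setT F by exact: measurable_funB.
rewrite -[LHS](@ge0_integral_pushforward _ _ _ _ R F mF leb D g)//; last first.
  exact: measurable_funTS.
pose m0 : {measure set (measurableTypeR R) -> \bar R} := pushforward leb F.
apply: eq_measure_integral => //= A mA _.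
apply/esym/(@lebesgue_measure_unique R (m0 mF)) => //= _ [[a b]] _ <-.
rewrite /pushforward [X in _ = leb X](_ : _ = `[d - b, d - a[%classic); last first.
  by apply/seteqP; split => x /=; rewrite /F !in_itv/=; lra.
rewrite !lebesgue_measure_itv/= !lte_fin ltrD2l ltrN2; case: ifP => // _.
by rewrite -!EFinB; congr (_%:E); ring.
Qed.

(** With [s] the radius, [acos (p / s)] has the right cosine and its sine is [|q| / s]; for [q < 0]
    the angle is replaced by [2 pi] minus it. *)
Lemma cos_sin_polar (p q : R) : exists2 b : R, 0 <= b <= pi *+ 2 &
  p = Num.sqrt (p ^+ 2 + q ^+ 2) * cos b /\ q = Num.sqrt (p ^+ 2 + q ^+ 2) * sin b.
Proof.
have pi0 := pi_gt0 R.
have pq0 : 0 <= p ^+ 2 + q ^+ 2 by rewrite addr_ge0 ?sqr_ge0.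
have := sqr_sqrtr pq0; have := sqrtr_ge0 (p ^+ 2 + q ^+ 2).
move: (Num.sqrt _) => s; rewrite le_eqVlt => /predU1P[<-|s0] s2.
  by exists 0; [rewrite lexx mulrn_wge0// ltW|rewrite !mul0r; split; nra].
have u1 : -1 <= p / s <= 1 by rewrite ler_pdivlMr// ler_pdivrMr//; nra.
have sb : s * sin (acos (p / s)) = `|q|.
  rewrite sin_acos// -{1}(gtr0_norm s0) -sqrtr_sqr -sqrtrM ?sqr_ge0// -[RHS]sqrtr_sqr.
  congr Num.sqrt; rewrite mulrBr mulr1 expr_div_n mulrC divfK; first by rewrite s2; ring.
  by rewrite expf_neq0// gt_eqF.
have cb : s * cos (acos (p / s)) = p by rewrite acosK ?in_itv//= mulrC divfK ?gt_eqF.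
have [b0 bpi] := (acos_ge0 u1, acos_lepi u1).
have [q0|q0] := leP 0 q.
  exists (acos (p / s)); first by rewrite b0/= mulr2n; lra.
  by rewrite sb cb ger0_norm.
exists (pi *+ 2 - acos (p / s)); first by rewrite mulr2n; lra.
rewrite addrC cosD2pi sinD2pi cosN sinN mulrN sb cb ltr0_norm// opprK.
by [].
Qed.

(** Write [p cos x + q sin x = s cos (x - b)]. Periodicity removes the phase [b], and evenness of
    the cosine folds the second half period onto the first. *)
Lemma ge0_integral_circle h (a p q : R) :
  measurable_fun setT h -> (forall x, 0 <= h x)%E ->
  (\int[leb]_(x in `[0%R, (2 * pi)%R[) h (a + (p * cos x + q * sin x))%R =
   2%:E * \int[leb]_(x in `[0%R, pi]) h (a + Num.sqrt (p ^+ 2 + q ^+ 2) * cos x)%R)%E.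
Proof.
move=> mh h0; have pi0 := pi_gt0 R.
have [b + []] := cos_sin_polar p q; set s := Num.sqrt _ => b02 ps qs.
pose K x := h (a + s * cos x).
have mK : measurable_fun setT K.
  apply: (measurableT_comp mh); apply: continuous_measurable_fun => x.
  by apply: cvgD; [exact: cvg_cst|apply: cvgM; [exact: cvg_cst|exact: continuous_cos]].
have K0 x : (0 <= K x)%E by exact: h0.
have KD x : K (x + pi *+ 2) = K x by rewrite /K cosD2pi.
have KN x : K (- x) = K x by rewrite /K cosN.
have mKs : measurable_fun setT (fun x : R => K (x - b)).
  by apply: (measurableT_comp mK); exact: measurable_funB.
rewrite mulr2n in b02 KD.
have split_itv (g : R -> \bar R) (u v w : R) : u <= v <= w -> measurable_fun setT g ->
    (forall x, 0 <= g x)%E ->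
    (\int[leb]_(x in `[u, w[) g x =
     \int[leb]_(x in `[u, v[) g x + \int[leb]_(x in `[v, w[) g x)%E.
  move=> uvw mg g0; rewrite -ge0_integral_setU//.
  - congr integral; apply/seteqP; split => x /=; rewrite !in_itv/=; last lra.
    by move=> /andP[ux xw]; have [xv|xv] := ltP x v; [left|right]; lra.
  - exact: measurable_funTS.
  - apply/disj_set2P/seteqP; split => x//=; rewrite !in_itv/=; lra.
transitivity (\int[leb]_(x in `[0%R, (2 * pi)%R[) K (x - b)%R)%E.
  apply: eq_integral => x _; rewrite /K cosD cosN sinN; congr h.
  by rewrite {1}ps {1}qs; ring.
(* Shifting by [-b] carries [[b, 2 pi[] to [[0, 2 pi - b[], and shifting by [2 pi - b] carries [[0,
   b[] to [[2 pi - b, 2 pi[]. *)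
transitivity (\int[leb]_(x in `[0%R, (2 * pi)%R[) K x)%E.
  rewrite (split_itv _ 0 b)//; last lra.
  rewrite [RHS](split_itv _ 0 (2 * pi - b))//; last lra.
  rewrite addeC; congr (_ + _)%E.
    rewrite -(ge0_integral_shift (- b) _ mK K0)//; congr integral.
    by apply/seteqP; split => x /=; rewrite !in_itv/=; lra.
  rewrite -(ge0_integral_shift (2 * pi - b) _ mK K0)//.
  rewrite [X in integral _ X _ = _](_ : _ = [set x | `[2 * pi - b, 2 * pi[%classic (x + (2 * pi - b))]).
    by apply: eq_integral => x _; rewrite -KD; congr K; ring.
  by apply/seteqP; split => x /=; rewrite !in_itv/=; lra.
rewrite (split_itv _ 0 pi)//; last lra.
rewrite [X in (X + _)%E]integral_itv_bndo_bndc; last exact: measurable_funTS.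
rewrite [X in (_ + X)%E](_ : _ = \int[leb]_(x in `[0%R, pi]) K x)%E.
  by rewrite -mule2n mule_natl.
rewrite integral_itv_bndoo; last exact: measurable_funTS.
rewrite [RHS]integral_itv_bndoo; last exact: measurable_funTS.
rewrite -[RHS](ge0_integral_reflect (2 * pi) _ mK K0)//.
rewrite [X in integral _ X _ = _](_ : _ = [set x | `]0%R, pi[%classic (2 * pi - x)]).
  by apply: eq_integral => x _; rewrite -KN -KD; congr K; ring.
by apply/seteqP; split => x /=; rewrite !in_itv/=; lra.
Qed.

(** Common form for the sphere ([G = cos], [S = sin]) and the hyperboloid ([cosh], [sinh]), with
    [(p, q, c)] the normalised center up to signs. The circle integral depends on [x] only through
    [z = G x], the substitution hypothesis passes to [z], and the average over latitudes
    concludes. *)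
Lemma ge0_integral_polar I Z (G S : R -> R) (c p q : R) h :
  measurable I -> measurable Z -> continuous G -> continuous S ->
  (forall x, I x -> 0 <= S x) ->
  (forall g, measurable_fun setT g -> (forall x, 0 <= g x)%E ->
    (\int[leb]_(x in I) (g (G x) * (S x)%:E) = \int[leb]_(z in Z) g z)%E) ->
  (forall x, I x ->
    (p ^+ 2 + q ^+ 2) * S x ^+ 2 = (1 - c ^+ 2) * (1 - G x ^+ 2)) ->
  (1 - c ^+ 2 != 0 -> forall z, Z z -> 0 < (1 - c ^+ 2) * (1 - z ^+ 2)) ->
  (forall z t, Z z -> 0 < (1 - c ^+ 2) * (1 - z ^+ 2) - (t - c * z) ^+ 2 -> Z t) ->
  (c = -1 -> forall z, Z (- z) <-> Z z) ->
  measurable_fun setT h -> (forall x, 0 <= h x)%E ->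
  (\int[leb \x leb]_(u in I `*` `[0%R, (2 * pi)%R[)
     (h (c * G u.1 + (S u.1 * p * cos u.2 + S u.1 * q * sin u.2))%R * (S u.1)%:E) =
   (2 * pi)%:E * \int[leb]_(z in Z) h z)%E.
Proof.
move=> mI mZ cG cS S0 subst norm Zpos Zt Zsym mh h0.
have pi0 := pi_gt0 R.
have mG := continuous_measurable_fun cG; have mS := continuous_measurable_fun cS.
have mcos := continuous_measurable_fun (@continuous_cos R).
have msin := continuous_measurable_fun (@continuous_sin R).
pose L z := (\int[leb]_(x in `[0%R, pi])
  h (c * z + Num.sqrt ((1 - c ^+ 2) * (1 - z ^+ 2)) * cos x)%R)%E.
have mL : measurable_fun setT L.
  pose H := (fun u : R * R => h (c * u.1 + Num.sqrt ((1 - c ^+ 2) * (1 - u.1 ^+ 2)) * cos u.2)).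
  have mH : measurable_fun setT H.
    apply: (measurableT_comp mh); apply: measurable_funD; first exact: measurable_funM.
    apply: measurable_funM; last exact: measurableT_comp.
    apply: (measurableT_comp (continuous_measurable_fun (@sqrt_continuous R))).
    apply: measurable_funM => //; apply: measurable_funB => //.
    exact: measurable_funX.
  have -> : L = fubini_F leb (H \_ (setT `*` `[0%R, pi])).
    apply/funext => z; rewrite /L /fubini_F [LHS]integral_mkcond.
    by apply: eq_integral => x _; rewrite !patchE in_setX in_setT.
  apply: measurable_fun_fubini_tonelli_F => [|u]; last by apply: erestrict_ge0 => v _; exact: h0.
  apply/(measurable_restrictT _ _).1; first exact: measurableX.
  exact: measurable_funTS.
have L0 z : (0 <= L z)%E by exact: integral_ge0.
have LZ : (\int[leb]_(z in Z) L z = pi%:E * \int[leb]_(z in Z) h z)%E.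
  (* If [c = 1] or [c = -1] the circles degenerate and the integrand is constantly [h (c z)]; for
     [c = -1] the symmetry of [Z] absorbs the sign. *)
  have [c1|c1] := eqVneq (1 - c ^+ 2) 0; last exact: ge0_integral_latitudes (Zpos c1) Zt mh h0.
  transitivity (\int[leb]_(z in Z) (pi%:E * h (c * z)%R))%E.
    apply: eq_integral => z _; rewrite /L c1 mul0r sqrtr0.
    under eq_integral => x _ do rewrite mul0r addr0.
    by rewrite integral_cst//= lebesgue_measure_itv/= lte_fin pi0 oppr0 adde0 muleC.
  rewrite ge0_integralZl//; last 2 first.
  - by apply: measurable_funTS; apply: (measurableT_comp mh); exact: measurable_funM.
  - by rewrite lee_fin ltW.
  congr (_ * _)%E.
  have : (c == 1) || (c == -1) by rewrite -eqf_sqr expr1n eq_sym -subr_eq0 c1.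
  case/predU1P => [->|/eqP cN1]; first by under eq_integral => x _ do rewrite mul1r.
  rewrite -[RHS](ge0_integral_reflect 0 mZ mh h0) cN1.
  rewrite [X in _ = integral _ X _](_ : _ = Z).
    by apply: eq_integral => x _; rewrite mulN1r sub0r.
  by apply/seteqP; split => x /=; rewrite sub0r => /(Zsym cN1).
have mhu : measurable_fun setT
    (fun u : R * R => h (c * G u.1 + (S u.1 * p * cos u.2 + S u.1 * q * sin u.2))).
  apply: (measurableT_comp mh); apply: measurable_funD.
    by apply: measurable_funM => //; exact: measurableT_comp.
  apply: measurable_funD; apply: measurable_funM; try exact: measurableT_comp.
    by apply: measurable_funM => //; exact: measurableT_comp.
  by apply: measurable_funM => //; exact: measurableT_comp.
(* The absolute value makes the integrand nonnegative everywhere, as [ge0_integral_setX] demands,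
   while [S] is nonnegative only on [I]. *)
transitivity (\int[leb \x leb]_(u in I `*` `[0%R, (2 * pi)%R[)
    (`|S u.1|%:E * h (c * G u.1 + (S u.1 * p * cos u.2 + S u.1 * q * sin u.2))%R))%E.
  by apply: eq_integral => u; rewrite inE => -[/= Iu _]; rewrite muleC ger0_norm ?S0.
rewrite (ge0_integral_setX (f := fun u => (`|S u.1|%:E *
  h (c * G u.1 + (S u.1 * p * cos u.2 + S u.1 * q * sin u.2))%R)%E))//=; last 2 first.
- apply: emeasurable_funM => //; apply/measurable_EFinP.
  by apply: measurableT_comp => //; exact: measurableT_comp.
- by move=> u; rewrite mule_ge0// lee_fin.
rewrite EFinM -muleA -LZ -subst//.
rewrite -ge0_integralZl//; last 2 first.
- apply: measurable_funTS; apply: emeasurable_funM.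
    exact: (measurableT_comp mL mG).
  exact/measurable_EFinP.
- by move=> x Ix; rewrite mule_ge0// lee_fin S0.
apply: eq_integral => x; rewrite inE => Ix.
have mhc : measurable_fun setT (fun y : R =>
    h (c * G x + (S x * p * cos y + S x * q * sin y))).
  exact: (measurableT_comp mhu (measurable_pair1 x)).
rewrite ge0_integralZl//; last exact: measurable_funTS.
rewrite ge0_integral_circle// ger0_norm ?S0// muleA (muleC (L _)) muleA (muleC 2%:E).
congr (_ * _)%E; apply: eq_integral => y _; congr (h (_ + Num.sqrt _ * _)).
by rewrite -norm// !exprMn; ring.
Qed.

End polar_coordinates.

(** * Areas of spherical and hyperbolic disks *)

Section areas.
Context {R : realType}.
Notation leb := (@lebesgue_measure R).
Implicit Types (r t : R) (A : pt R).

Lemma ler_acos : {in `[-1, 1] &, {mono (@acos R) : x y /~ x <= y}}.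
Proof.
move=> x y; rewrite !in_itv/= => x1 y1.
rewrite leNgt -ltr_cos ?acosK ?in_itv//= ?acos_ge0 ?acos_lepi//.
by rewrite -leNgt.
Qed.

Lemma ler_acosh : {in `[1, +oo[ &, {mono (@acosh R) : x y / x <= y}}.
Proof.
move=> x y; rewrite !in_itv/= !andbT => x1 y1.
by rewrite -ler_cosh ?in_itv/= ?acosh_ge0// !acoshK.
Qed.

(** The sum and the difference of the two vectors have nonnegative squared length. *)
Lemma dot_sphere r (x y z x' y' z' : R) : 0 < r ->
  x ^+ 2 + y ^+ 2 + z ^+ 2 = r ^+ 2 -> x' ^+ 2 + y' ^+ 2 + z' ^+ 2 = r ^+ 2 ->
  -1 <= (x * x' + y * y' + z * z') / r ^+ 2 <= 1.
Proof.
move=> r0 h h'; have r2 : 0 < r ^+ 2 by rewrite exprn_gt0.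
have := sqr_ge0 (x - x'); have := sqr_ge0 (y - y'); have := sqr_ge0 (z - z').
have := sqr_ge0 (x + x'); have := sqr_ge0 (y + y'); have := sqr_ge0 (z + z').
by rewrite ler_pdivlMr// ler_pdivrMr//; lra.
Qed.

(** Reverse Cauchy-Schwarz: by Lagrange's identity [(x x' + y y')^2 <= (z^2 - r^2) (z'^2 - r^2)],
    and the right side is [(z z' - r^2)^2 - r^2 (z - z')^2]. *)
Lemma dot_hyper r (x y z x' y' z' : R) : 0 < r ->
  x ^+ 2 + y ^+ 2 - z ^+ 2 = - r ^+ 2 -> 0 < z ->
  x' ^+ 2 + y' ^+ 2 - z' ^+ 2 = - r ^+ 2 -> 0 < z' ->
  1 <= (z * z' - x * x' - y * y') / r ^+ 2.
Proof.
move=> r0 h z0 h' z'0; have r2 : 0 < r ^+ 2 by rewrite exprn_gt0.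
rewrite ler_pdivlMr// mul1r.
have rz : r <= z.
  rewrite -(@ler_pXn2r _ 2) ?nnegrE ?(ltW r0) ?(ltW z0) ?(ltW z'0)//.
  by have := sqr_ge0 x; have := sqr_ge0 y; lra.
have rz' : r <= z'.
  rewrite -(@ler_pXn2r _ 2) ?nnegrE ?(ltW r0) ?(ltW z0) ?(ltW z'0)//.
  by have := sqr_ge0 x'; have := sqr_ge0 y'; lra.
have zz : 0 <= z * z' - r ^+ 2 by rewrite subr_ge0 expr2 ler_pM// ltW.
suff : x * x' + y * y' <= z * z' - r ^+ 2 by lra.
apply: (le_trans (ler_norm _)).
rewrite -(@ler_pXn2r _ 2) ?nnegrE// -normrX ger0_norm ?sqr_ge0//.
have cs : (x * x' + y * y') ^+ 2 + (x * y' - y * x') ^+ 2 =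
  (x ^+ 2 + y ^+ 2) * (x' ^+ 2 + y' ^+ 2) by ring.
have e : x ^+ 2 + y ^+ 2 = z ^+ 2 - r ^+ 2 by lra.
have e' : x' ^+ 2 + y' ^+ 2 = z' ^+ 2 - r ^+ 2 by lra.
rewrite e e' in cs; have := sqr_ge0 (x * y' - y * x').
have := mulr_ge0 (ltW r2) (sqr_ge0 (z - z')); nra.
Qed.

(** Archimedes' hat-box principle for an arbitrary axis: when [P] only constrains the height along
    the axis of [(p, q, c)], [ge0_integral_polar] for the indicator of [H] reduces the area to a
    length. *)
Lemma integral_polar_zone (I Z H : set R) (G S : R -> R) (c p q r : R)
    (P : set (R * R)) :
  measurable I -> measurable Z -> measurable H -> continuous G -> continuous S ->
  (forall x, I x -> 0 <= S x) ->
  (forall g, measurable_fun setT g -> (forall x, 0 <= g x)%E ->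
    (\int[leb]_(x in I) (g (G x) * (S x)%:E) = \int[leb]_(z in Z) g z)%E) ->
  (forall x, I x ->
    (p ^+ 2 + q ^+ 2) * S x ^+ 2 = (1 - c ^+ 2) * (1 - G x ^+ 2)) ->
  (1 - c ^+ 2 != 0 -> forall z, Z z -> 0 < (1 - c ^+ 2) * (1 - z ^+ 2)) ->
  (forall z t, Z z -> 0 < (1 - c ^+ 2) * (1 - z ^+ 2) - (t - c * z) ^+ 2 -> Z t) ->
  (c = -1 -> forall z, Z (- z) <-> Z z) ->
  (forall x y, I x -> P (x, y) <->
    H (c * G x + (S x * p * cos y + S x * q * sin y))) ->
  (\int[leb \x leb]_(u in I `*` `[0%R, (2 * pi)%R[)
     (if `[< P u >] then r ^+ 2 * S u.1 else 0)%:E =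
   (2 * pi * r ^+ 2)%:E * leb (Z `&` H))%E.
Proof.
move=> mI mZ mH cG cS S0 subst norm Zpos Zt Zsym PH.
have mG := continuous_measurable_fun cG; have mS := continuous_measurable_fun cS.
have mcos := continuous_measurable_fun (@continuous_cos R).
have msin := continuous_measurable_fun (@continuous_sin R).
pose h (z : R) : \bar R := (\1_H z)%:E.
have mh : measurable_fun setT h by exact/measurable_EFinP.
have h0 x : (0 <= h x)%E by rewrite lee_fin.
have r20 : (0 <= (r ^+ 2)%:E)%E by rewrite lee_fin sqr_ge0.
transitivity (\int[leb \x leb]_(u in I `*` `[0%R, (2 * pi)%R[)
  ((r ^+ 2)%:E * (h (c * G u.1 + (S u.1 * p * cos u.2 + S u.1 * q * sin u.2))%R *
   (S u.1)%:E)))%E.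
  apply: eq_integral => -[x y]; rewrite inE => -[/= Ix _].
  rewrite /h indicE; have [Hx|Hx] := boolP (_ \in H).
    rewrite ifT ?mul1e//; apply/asboolP/PH => //; exact: set_mem.
  rewrite ifF ?mul0e ?mule0//; apply/asboolPn => /PH => /(_ Ix).
  by move/mem_set; rewrite (negbTE Hx).
rewrite ge0_integralZl//; last 3 first.
- exact: measurableX.
- apply: measurable_funTS; apply: emeasurable_funM; last first.
    by apply/measurable_EFinP; exact: measurableT_comp.
  apply: (measurableT_comp mh); apply: measurable_funD.
    by apply: measurable_funM => //; exact: measurableT_comp.
  apply: measurable_funD; apply: measurable_funM; try exact: measurableT_comp.
    by apply: measurable_funM => //; exact: measurableT_comp.
  by apply: measurable_funM => //; exact: measurableT_comp.
- by move=> u [Iu _]; rewrite mule_ge0// lee_fin S0.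
rewrite (ge0_integral_polar (G := G) (S := S) (Z := Z))// muleA -EFinM mulrC.
by rewrite integral_indic// setIC.
Qed.

Lemma area_sphere_cap r A t : 0 < r -> onX Sphere r A -> -1 <= t <= 1 ->
  areaX Sphere r (disk Sphere r A (r * acos t)) = (2 * pi * r ^+ 2 * (1 - t))%:E.
Proof.
move=> r0 /= hA t1.
have r2 : 0 < r ^+ 2 by rewrite exprn_gt0.
have rn0 : r != 0 by rewrite gt_eqF.
pose c := pz A / r; pose p := px A / r; pose q := py A / r.
have pqc : p ^+ 2 + q ^+ 2 = 1 - c ^+ 2.
  rewrite /p /q /c !expr_div_n -mulrDl; apply: (mulIf (lt0r_neq0 r2)).
  rewrite mulrBl !divfK ?lt0r_neq0//; lra.
have c1 : c ^+ 2 <= 1 by have := sqr_ge0 p; have := sqr_ge0 q; lra.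
rewrite /areaX/= (integral_polar_zone (G := cos) (S := sin) (c := c) (p := p)
  (q := q) (Z := `]-1, 1[%classic) (H := `[t, +oo[%classic))//.
- rewrite [X in leb X](_ : _ = if t == -1 then `]t, 1[%classic else `[t, 1[%classic); last first.
    (* [Z] omits the pole height [-1], so the zone is open on the left exactly when [t = -1]. *)
    case: eqVneq => [->|tN1]; apply/seteqP; split => x/=; rewrite !in_itv/= ?andbT; lra.
  rewrite (fun_if leb) !lebesgue_measure_itv/= if_same lte_fin.
  case: ltP => [_|t1']; first by rewrite -EFinB -EFinM.
  rewrite mule0; congr (_%:E).
  rewrite (_ : t = 1) ?subrr ?mulr0//; lra.
- exact: continuous_cos.
- exact: continuous_sin.
- by move=> x; rewrite /= in_itv/=; exact: sin_ge0_pi.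
- move=> g mg g0.
  have := ge0_integral_affine_cos 0 ltr01 mg g0.
  under eq_integral => x _ do rewrite add0r !mul1r.
  by move=> ->; rewrite sub0r add0r integral_itv_bndoo//; exact: measurable_funTS.
- by move=> x _; rewrite pqc sin2cos2.
- move=> c10 z; rewrite /= in_itv/= => z1.
  by rewrite mulr_gt0// ?lt0r ?c10/=; nra.
- move=> z t'; rewrite /= !in_itv/= => z1 D.
  have z21 : 0 <= 1 - z ^+ 2 by nra.
  (* By symmetry the radicand is also [(1 - c^2) (1 - t'^2) - (z - c t')^2]. *)
  have D' : 0 < (1 - c ^+ 2) * (1 - t' ^+ 2) by have := sqr_ge0 (z - c * t'); nra.
  have c1' : 0 <= 1 - c ^+ 2 by lra.
  have t1' : 0 < 1 - t' ^+ 2.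
    by rewrite ltNge; apply/negP => /(mulr_ge0_le0 c1'); rewrite leNgt D'.
  nra.
- by move=> _ z; rewrite /= !in_itv/=; lra.
move=> x y _; rewrite /disk/= !in_itv/= andbT.
have P1 : (r * sin x * cos y) ^+ 2 + (r * sin x * sin y) ^+ 2 + (r * cos x) ^+ 2 = r ^+ 2.
  by rewrite !exprMn -mulrDr cos2Dsin2 mulr1 -mulrDr addrC cos2Dsin2 mulr1.
have := dot_sphere r0 hA P1; rewrite ler_pM2l//.
have -> : (px A * (r * sin x * cos y) + py A * (r * sin x * sin y) + pz A * (r * cos x)) / r ^+ 2
    = c * cos x + (sin x * p * cos y + sin x * q * sin y).
  by rewrite /p /q /c; field.
by move=> d1; rewrite ler_acos ?in_itv//=; split => [[]|].
Qed.

Lemma area_hyper_cap r A t : 0 < r -> onX Hyper r A -> 1 <= t ->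
  areaX Hyper r (disk Hyper r A (r * acosh t)) = (2 * pi * r ^+ 2 * (t - 1))%:E.
Proof.
move=> r0 /= [hA zA0] t1.
have r2 : 0 < r ^+ 2 by rewrite exprn_gt0.
have rn0 : r != 0 by rewrite gt_eqF.
(* The signs of [p] and [q] absorb those of the Minkowski product, so that the height keeps the form
   [c z + ...]. *)
pose c := pz A / r; pose p := - px A / r; pose q := - py A / r.
have pqc : p ^+ 2 + q ^+ 2 = c ^+ 2 - 1.
  rewrite /p /q /c !expr_div_n -mulrDl; apply: (mulIf (lt0r_neq0 r2)).
  rewrite mulrBl !divfK ?lt0r_neq0// !sqrrN; lra.
have c0 : 0 < c by rewrite divr_gt0.
have c21 : 1 <= c ^+ 2 by have := sqr_ge0 p; have := sqr_ge0 q; lra.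
have c1 : 1 <= c by nra.
rewrite /areaX/= (integral_polar_zone (G := @cosh R) (S := @sinh R) (c := c) (p := p)
  (q := q) (Z := `]1, +oo[%classic) (H := `]-oo, t]%classic))//.
- rewrite [X in leb X](_ : _ = `]1, t]%classic); last first.
    by apply/seteqP; split => x/=; rewrite !in_itv/= ?andbT; lra.
  rewrite lebesgue_measure_itv/= lte_fin.
  case: ltP => [_|t1']; first by rewrite -EFinB -EFinM.
  rewrite mule0; congr (_%:E).
  rewrite (_ : t = 1) ?subrr ?mulr0//; lra.
- exact: continuous_cosh.
- exact: continuous_sinh.
- by move=> x; rewrite /= in_itv/= andbT; exact: sinh_ge0.
- move=> g mg g0; rewrite ge0_integral_cosh//.
  by rewrite integral_itv_obnd_cbnd//; exact: measurable_funTS.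
- by move=> x _; rewrite pqc; have := cosh2_sinh2 x => /(canRL (subrK _)) ->; ring.
- move=> c10 z; rewrite /= in_itv/= andbT => z1.
  have c2 : 1 - c ^+ 2 < 0 by rewrite lt_neqAle c10/=; lra.
  by rewrite nmulr_rgt0//; nra.
- move=> z t'; rewrite /= !in_itv/= !andbT => z1 D.
  have D' : 0 < (c ^+ 2 - 1) * (t' ^+ 2 - 1) by have := sqr_ge0 (z - c * t'); nra.
  have c1' : 0 <= c ^+ 2 - 1 by lra.
  have t1' : 0 < t' ^+ 2 - 1.
    by rewrite ltNge; apply/negP => /(mulr_ge0_le0 c1'); rewrite leNgt D'.
  (* This excludes the branch [t' < -1]: for [t' <= 0] the radicand
     [1 - c^2 - z^2 - t'^2 + 2 c z t'] cannot be positive, since [c >= 1] and [z > 1]. *)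
  have t'0 : 0 < t'.
    rewrite ltNge; apply/negP => t'0.
    have cz : c * z * t' <= 0 by rewrite mulr_ge0_le0// mulr_ge0// ltW// (lt_trans _ z1).
    have := sqr_ge0 t'; nra.
  nra.
- by move=> cN1; exfalso; lra.
move=> x y; rewrite /disk/= !in_itv/= andbT => x0.
have P1 : (r * sinh x * cos y) ^+ 2 + (r * sinh x * sin y) ^+ 2 - (r * cosh x) ^+ 2 = - r ^+ 2.
  have := cosh2_sinh2 x; move: (cosh x) (sinh x) => C S.
  rewrite !exprMn -mulrDr cos2Dsin2 mulr1 => /(canRL (subrK _)) ->; ring.
have P2 : 0 < r * cosh x by rewrite mulr_gt0// (lt_le_trans ltr01)// cosh_ge1.
have := dot_hyper r0 hA zA0 P1 P2; rewrite ler_pM2l//.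
have -> : (pz A * (r * cosh x) - px A * (r * sinh x * cos y) - py A * (r * sinh x * sin y)) / r ^+ 2
    = c * cosh x + (sinh x * p * cos y + sinh x * q * sin y).
  by rewrite /p /q /c; field.
by move=> d1; rewrite ler_acosh ?in_itv/= ?andbT//; split => [[]|].
Qed.

End areas.

(** * Area of a Euclidean disk, and midpoints in the ambient space *)

Section equiangular.
Context {R : realType}.
Notation leb := (@lebesgue_measure R).
Implicit Types (r : R) (A B D M : pt R).

(** Sections at fixed [x] have length [2 sqrt (rho^2 - (x - a)^2)], and [x = a + rho cos] turns
    their integral into [rho^2] times a constant. That constant stays an integral, as only its
    independence of [rho] matters for additivity. *)
Lemma area_euclid_disk r A (rho : R) : pz A = 0 -> 0 < rho ->
  areaX Euclid r (disk Euclid r A rho) =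
  ((rho ^+ 2)%:E * \int[leb]_(x in `[0%R, pi]) (2 * sin x ^+ 2)%:E)%E.
Proof.
move=> zA rho0; rewrite /areaX/=; pose a := px A; pose b := py A.
pose Q (u : R * R) := rho ^+ 2 - (u.1 - a) ^+ 2 - (u.2 - b) ^+ 2.
pose w (x : R) := 2 * Num.sqrt (rho ^+ 2 - (x - a) ^+ 2).
have mw : measurable_fun setT w.
  apply: measurable_funM => //.
  apply: (measurableT_comp (continuous_measurable_fun (@sqrt_continuous R))).
  apply: measurable_funB => //; apply: measurable_funX; exact: measurable_funB.
have mD : measurable [set u | 0 <= Q u].
  have mQ : measurable_fun setT Q.
    apply: measurable_funB; last by apply: measurable_funX; exact: measurable_funB.
    by apply: measurable_funB => //; apply: measurable_funX; exact: measurable_funB.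
  rewrite (_ : [set u | _] = Q @^-1` `[0, +oo[%classic).
    by rewrite -[X in measurable X]setTI; exact: mQ.
  by apply/seteqP; split => u /=; rewrite in_itv/= andbT.
transitivity (\int[leb \x leb]_(u in setT `*` setT) (\1_[set u | 0 <= Q u] u)%:E)%E.
  rewrite setXTT; apply: eq_integral => -[x y] _ /=; rewrite indicE.
  have e : (px A - x) ^+ 2 + (py A - y) ^+ 2 + (pz A - 0) ^+ 2 = rho ^+ 2 - Q (x, y).
    by rewrite zA /Q /a /b/=; ring.
  have s0 : 0 <= rho ^+ 2 - Q (x, y).
    by rewrite -e !addr_ge0 ?sqr_ge0.
  have iff : (Num.sqrt (rho ^+ 2 - Q (x, y)) <= rho) = (0 <= Q (x, y)).
    rewrite -(@ler_pXn2r _ 2) ?nnegrE ?sqrtr_ge0 ?(ltW rho0)// sqr_sqrtr//.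
    by rewrite gerBl.
  have [Q0|Q0] := boolP (0 <= Q (x, y)).
    rewrite ifT ?mem_set//; apply/asboolP; split => //=.
    by rewrite /px /py /pz /= in e *; rewrite e iff.
  rewrite memNset ?(negbTE Q0)//; last exact/negP.
  rewrite ifF//; apply/asboolPn => -[_] /=.
  by rewrite /px /py /pz /= in e *; rewrite e iff; exact/negP.
rewrite ge0_integral_setX//=; last exact/measurable_EFinP.
transitivity (\int[leb]_(x in `[(a - rho)%R, (a + rho)%R]) (w x)%:E)%E.
  rewrite [RHS]integral_mkcond; apply: eq_integral => x _; rewrite patchE.
  pose v := rho ^+ 2 - (x - a) ^+ 2.
  transitivity (leb [set y | 0 <= Q (x, y)]).
    rewrite -[LHS](_ : \int[leb]_y (\1_[set y | 0 <= Q (x, y)] y)%:E = _)%E; last first.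
      by apply: eq_integral => y _; rewrite !indicE; congr ((nat_of_bool _)%:R%:E); apply/idP/idP; rewrite !inE.
    rewrite integral_indic ?setIT//.
    have := measurable_xsection x mD; congr measurable.
    by apply/seteqP; split => y /=; rewrite /xsection/= inE.
  have [v0|v0] := leP 0 v.
    rewrite mem_set; last by rewrite /= in_itv/=; move: v0; rewrite /v; nra.
    rewrite /w -/v.
    have := sqrtr_ge0 v; have := sqr_sqrtr v0; move: (Num.sqrt v) => s sv s0.
    rewrite (_ : [set y | _] = `[b - s, b + s]%classic); last first.
      apply/seteqP; split => y; rewrite /Q/= -/v in_itv/= subr_ge0 -sv;
      by rewrite -(real_normK (num_real (y - b))) ler_pXn2r ?nnegrE// ler_norml; lra.
    rewrite lebesgue_measure_itv/= lte_fin.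
    case: ltP => [_|s1]; first by rewrite -EFinB; congr (_%:E); ring.
    by congr (_%:E); lra.
  rewrite memNset; last by rewrite /= in_itv/=; move: v0; rewrite /v; nra.
  rewrite (_ : [set y | _] = set0) ?measure0//.
  apply/seteqP; split => y//=; rewrite /Q/= -/v; have := sqr_ge0 (y - b); lra.
rewrite -(ge0_integral_affine_cos a rho0 (g := EFin \o w)); last 2 first.
- exact/measurable_EFinP.
- by move=> x; rewrite lee_fin mulr_ge0// sqrtr_ge0.
rewrite -ge0_integralZl//; last 3 first.
- apply: continuous_measurable_EFin => x.
  by apply: cvgM; [exact: cvg_cst|apply: cvgM; exact: continuous_sin].
- by move=> x _; rewrite lee_fin mulr_ge0// sqr_ge0.
- by rewrite lee_fin sqr_ge0.
apply: eq_integral => x; rewrite inE/= in_itv/= => /sin_ge0_pi s0.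
rewrite -!EFinM /w (_ : _ - _ = (rho * sin x) ^+ 2); last first.
  by rewrite exprMn sin2cos2; ring.
rewrite sqrtr_sqr ger0_norm; last by rewrite mulr_ge0// ltW.
by congr (_%:E); ring.
Qed.

(** The hyperbolic sign makes [inner A A = r ^+ 2] on both curved surfaces, and [inner A B / r ^+ 2]
    the cosine, resp. hyperbolic cosine, of the distance over [r]. *)
Definition inner (k : model) A B : R :=
  match k with
  | Hyper => pz A * pz B - px A * px B - py A * py B
  | _ => px A * px B + py A * py B + pz A * pz B
  end.

Lemma pt_ext A B : px A = px B -> py A = py B -> pz A = pz B -> A = B.
Proof. by case: A B => [[a1 a2] a3] [[b1 b2] b3]; rewrite /px /py /pz /= => -> -> ->. Qed.

(* If [M] is the midpoint of [AD] then [A + D = 2 k M] in the ambient space, where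
   [k] is the (hyperbolic) cosine of half the length: the difference [v] satisfies
   [v.v = v.M = 0], and is zero since [M] is timelike in the hyperbolic case. *)
Lemma sphere_midpoint r (k : R) A D M : onX Sphere r A -> onX Sphere r D ->
  onX Sphere r M ->
  inner Sphere A M = k * r ^+ 2 -> inner Sphere M D = k * r ^+ 2 ->
  inner Sphere A D = (2 * k ^+ 2 - 1) * r ^+ 2 ->
  [/\ px A + px D = 2 * k * px M, py A + py D = 2 * k * py M &
      pz A + pz D = 2 * k * pz M].
Proof.
rewrite /= => hA hD hM hAM hMD hAD.
have : (px A + px D - 2 * k * px M) ^+ 2 + (py A + py D - 2 * k * py M) ^+ 2 +
   (pz A + pz D - 2 * k * pz M) ^+ 2 = 0.
  transitivity ((px A ^+ 2 + py A ^+ 2 + pz A ^+ 2) + (px D ^+ 2 + py D ^+ 2 + pz D ^+ 2)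
    + 4 * k ^+ 2 * (px M ^+ 2 + py M ^+ 2 + pz M ^+ 2)
    + 2 * (px A * px D + py A * py D + pz A * pz D)
    - 4 * k * (px A * px M + py A * py M + pz A * pz M)
    - 4 * k * (px M * px D + py M * py D + pz M * pz D)); first by ring.
  by rewrite hA hD hM hAM hMD hAD; ring.
move/eqP; rewrite paddr_eq0 ?addr_ge0 ?sqr_ge0// paddr_eq0 ?sqr_ge0//.
by rewrite !sqrf_eq0 !subr_eq0 => /andP[/andP[/eqP-> /eqP->] /eqP->].
Qed.

Lemma hyper_midpoint r (k : R) A D M : 0 < r -> onX Hyper r A -> onX Hyper r D ->
  onX Hyper r M ->
  inner Hyper A M = k * r ^+ 2 -> inner Hyper M D = k * r ^+ 2 ->
  inner Hyper A D = (2 * k ^+ 2 - 1) * r ^+ 2 ->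
  [/\ px A + px D = 2 * k * px M, py A + py D = 2 * k * py M &
      pz A + pz D = 2 * k * pz M].
Proof.
rewrite /= => r0 [hA _] [hD _] [hM _] hAM hMD hAD.
pose x := px A + px D - 2 * k * px M; pose y := py A + py D - 2 * k * py M.
pose z := pz A + pz D - 2 * k * pz M.
have vv : x ^+ 2 + y ^+ 2 = z ^+ 2.
  apply/eqP; rewrite -subr_eq0; apply/eqP; rewrite /x /y /z.
  transitivity ((px A ^+ 2 + py A ^+ 2 - pz A ^+ 2) + (px D ^+ 2 + py D ^+ 2 - pz D ^+ 2)
    + 4 * k ^+ 2 * (px M ^+ 2 + py M ^+ 2 - pz M ^+ 2)
    - 2 * (pz A * pz D - px A * px D - py A * py D)
    + 4 * k * (pz A * pz M - px A * px M - py A * py M)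
    + 4 * k * (pz M * pz D - px M * px D - py M * py D)); first by ring.
  by rewrite hA hD hM hAM hMD hAD; ring.
have vM : z * pz M = x * px M + y * py M.
  apply/eqP; rewrite -subr_eq0; apply/eqP; rewrite /x /y /z.
  transitivity ((pz A * pz M - px A * px M - py A * py M)
    + (pz M * pz D - px M * px D - py M * py D)
    + 2 * k * (px M ^+ 2 + py M ^+ 2 - pz M ^+ 2)); first by ring.
  by rewrite hM hAM hMD; ring.
(* Lagrange's identity with [vv] and [vM] gives [z^2 pz(M)^2 <= z^2 (pz(M)^2 - r^2)], hence
   [z = 0]. *)
have cs : (x * px M + y * py M) ^+ 2 + (x * py M - y * px M) ^+ 2 =
  (x ^+ 2 + y ^+ 2) * (px M ^+ 2 + py M ^+ 2) by ring.
have e : px M ^+ 2 + py M ^+ 2 = pz M ^+ 2 - r ^+ 2 by lra.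
have z0 : z = 0.
  rewrite vv -vM e in cs.
  have : z ^+ 2 * r ^+ 2 <= 0 by have := sqr_ge0 (x * py M - y * px M); lra.
  rewrite pmulr_lle0 ?exprn_gt0// => z2.
  by apply/eqP; rewrite -sqrf_eq0 eq_le z2 sqr_ge0.
have : x ^+ 2 + y ^+ 2 = 0 by rewrite vv z0 expr0n.
move/eqP; rewrite paddr_eq0 ?sqr_ge0// !sqrf_eq0 !subr_eq0 => /andP[/eqP-> /eqP->].
by split => //; apply/eqP; rewrite -subr_eq0; exact/eqP.
Qed.

End equiangular.

(** * The Pythagorean relation in each geometry *)

Section pythagoras.
Context {R : realType}.
Implicit Types (r : R) (A B C D M P Q : pt R).

(** [P] and [Q] are kept apart from [A] and [D], so that all four half-diagonals yield literally the
    same constant [k] for the midpoint lemma. *)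
Lemma sphere_dist_half r A D P Q : 0 < r -> onX Sphere r P -> onX Sphere r Q ->
  distX Sphere r P Q = distX Sphere r A D / 2 ->
  inner Sphere P Q = cos (distX Sphere r A D / (2 * r)) * r ^+ 2.
Proof.
move=> r0 hP hQ e; have rn0 : r != 0 by rewrite gt_eqF.
have -> : distX Sphere r A D / (2 * r) = acos (inner Sphere P Q / r ^+ 2).
  by apply: (mulfI rn0); rewrite -[RHS]/(distX Sphere r P Q) e; field.
by rewrite acosK ?divfK ?expf_neq0// in_itv/=; exact: dot_sphere.
Qed.

(** The duplication formula for the cosine, in the shape that [sphere_midpoint] takes. *)
Lemma sphere_dist_double r A D : 0 < r -> onX Sphere r A -> onX Sphere r D ->
  inner Sphere A D = (2 * cos (distX Sphere r A D / (2 * r)) ^+ 2 - 1) * r ^+ 2.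
Proof.
move=> r0 hA hD; have rn0 : r != 0 by rewrite gt_eqF.
rewrite mulr_natl -cos_mulr2n.
have -> : (distX Sphere r A D / (2 * r)) *+ 2 = acos (inner Sphere A D / r ^+ 2).
  by apply: (mulfI rn0); rewrite -[RHS]/(distX Sphere r A D); field.
by rewrite acosK ?divfK ?expf_neq0// in_itv/=; exact: dot_sphere.
Qed.

Lemma hyper_dist_half r A D P Q : 0 < r -> onX Hyper r P -> onX Hyper r Q ->
  distX Hyper r P Q = distX Hyper r A D / 2 ->
  inner Hyper P Q = cosh (distX Hyper r A D / (2 * r)) * r ^+ 2.
Proof.
move=> r0 [hP zP] [hQ zQ] e; have rn0 : r != 0 by rewrite gt_eqF.
have -> : distX Hyper r A D / (2 * r) = acosh (inner Hyper P Q / r ^+ 2).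
  by apply: (mulfI rn0); rewrite -[RHS]/(distX Hyper r P Q) e; field.
by rewrite acoshK ?divfK ?expf_neq0//; exact: dot_hyper.
Qed.

Lemma hyper_dist_double r A D : 0 < r -> onX Hyper r A -> onX Hyper r D ->
  inner Hyper A D = (2 * cosh (distX Hyper r A D / (2 * r)) ^+ 2 - 1) * r ^+ 2.
Proof.
move=> r0 [hA zA] [hD zD]; have rn0 : r != 0 by rewrite gt_eqF.
have cosh2 (x : R) : 2 * cosh x ^+ 2 - 1 = cosh (x *+ 2).
  rewrite /cosh mulr2n opprD !expRD; have := expRxMexpNx_1 x.
  move: (expR x) (expR (- x)) => a b ab.
  rewrite (_ : 2 * _ = (a * a + b * b + 2 * (a * b)) / 2); last by field.
  by rewrite ab; field.
rewrite cosh2.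
have -> : (distX Hyper r A D / (2 * r)) *+ 2 = acosh (inner Hyper A D / r ^+ 2).
  by apply: (mulfI rn0); rewrite -[RHS]/(distX Hyper r A D); field.
by rewrite acoshK ?divfK ?expf_neq0//; exact: dot_hyper.
Qed.

Lemma sphere_pythagoras r A B D C M : 0 < r ->
  onX Sphere r A -> onX Sphere r B -> onX Sphere r D -> onX Sphere r C ->
  onX Sphere r M -> distX Sphere r A D = distX Sphere r B C ->
  distX Sphere r A M = distX Sphere r A D / 2 ->
  distX Sphere r M D = distX Sphere r A D / 2 ->
  distX Sphere r B M = distX Sphere r B C / 2 ->
  distX Sphere r M C = distX Sphere r B C / 2 ->
  inner Sphere A B + inner Sphere A C = r ^+ 2 + inner Sphere A D.
Proof.
(* Equal diagonals give both midpoint relations the same [k], so that [A + D] and [B + C] are the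
   same multiple of [M]. *)
move=> r0 hA hB hD hC hM e AM MD BM MC; rewrite -e in BM MC.
have := sphere_dist_double r0 hB hC; rewrite -e => BC.
have [x1 y1 z1] := sphere_midpoint hA hD hM (sphere_dist_half r0 hA hM AM)
  (sphere_dist_half r0 hM hD MD) (sphere_dist_double r0 hA hD).
have [x2 y2 z2] := sphere_midpoint hB hC hM (sphere_dist_half r0 hB hM BM)
  (sphere_dist_half r0 hM hC MC) BC.
rewrite -hA /inner.
transitivity (px A * (px B + px C) + py A * (py B + py C) + pz A * (pz B + pz C)); first by ring.
by rewrite x2 -x1 y2 -y1 z2 -z1; ring.
Qed.

Lemma hyper_pythagoras r A B D C M : 0 < r ->
  onX Hyper r A -> onX Hyper r B -> onX Hyper r D -> onX Hyper r C ->
  onX Hyper r M -> distX Hyper r A D = distX Hyper r B C ->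
  distX Hyper r A M = distX Hyper r A D / 2 ->
  distX Hyper r M D = distX Hyper r A D / 2 ->
  distX Hyper r B M = distX Hyper r B C / 2 ->
  distX Hyper r M C = distX Hyper r B C / 2 ->
  inner Hyper A B + inner Hyper A C = r ^+ 2 + inner Hyper A D.
Proof.
move=> r0 hA hB hD hC hM e AM MD BM MC; rewrite -e in BM MC.
have := hyper_dist_double r0 hB hC; rewrite -e => BC.
have [x1 y1 z1] := hyper_midpoint r0 hA hD hM (hyper_dist_half r0 hA hM AM)
  (hyper_dist_half r0 hM hD MD) (hyper_dist_double r0 hA hD).
have [x2 y2 z2] := hyper_midpoint r0 hB hC hM (hyper_dist_half r0 hB hM BM)
  (hyper_dist_half r0 hM hC MC) BC.
have -> : r ^+ 2 = pz A ^+ 2 - px A ^+ 2 - py A ^+ 2 by case: hA; lra.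
rewrite /inner.
transitivity (pz A * (pz B + pz C) - px A * (px B + px C) - py A * (py B + py C)); first by ring.
by rewrite x2 -x1 y2 -y1 z2 -z1; ring.
Qed.

Lemma euclid_dist_sqr r A B : distX Euclid r A B ^+ 2 =
  (px A - px B) ^+ 2 + (py A - py B) ^+ 2 + (pz A - pz B) ^+ 2.
Proof. by rewrite sqr_sqrtr// !addr_ge0 ?sqr_ge0. Qed.

Lemma euclid_dist_gt0 r A B : A <> B -> 0 < distX Euclid r A B.
Proof.
move=> AB; rewrite lt0r sqrtr_ge0 andbT; apply/eqP => e; apply: AB.
have /eqP : distX Euclid r A B ^+ 2 = 0 by rewrite e expr0n.
rewrite euclid_dist_sqr paddr_eq0 ?addr_ge0 ?sqr_ge0// paddr_eq0 ?sqr_ge0//.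
rewrite !sqrf_eq0 !subr_eq0 => /andP[/andP[/eqP x /eqP y] /eqP z].
exact: pt_ext.
Qed.

(** Parallelogram law: [|A + D - 2 M|^2 = 2 |AM|^2 + 2 |MD|^2 - |AD|^2], which vanishes here. *)
Lemma euclid_midpoint r A D M :
  distX Euclid r A M = distX Euclid r A D / 2 ->
  distX Euclid r M D = distX Euclid r A D / 2 ->
  [/\ px A + px D = 2 * px M, py A + py D = 2 * py M & pz A + pz D = 2 * pz M].
Proof.
move=> /(congr1 (fun x => x ^+ 2)) + /(congr1 (fun x => x ^+ 2)).
rewrite !expr_div_n !euclid_dist_sqr => AM MD.
have : (px A + px D - 2 * px M) ^+ 2 + (py A + py D - 2 * py M) ^+ 2 +
  (pz A + pz D - 2 * pz M) ^+ 2 = 0 by lra.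
move/eqP; rewrite paddr_eq0 ?addr_ge0 ?sqr_ge0// paddr_eq0 ?sqr_ge0//.
by rewrite !sqrf_eq0 !subr_eq0 => /andP[/andP[/eqP-> /eqP->] /eqP->].
Qed.

(** The common midpoint gives [D = B + C - A], and then equality of the diagonals says that [B - A]
    and [C - A] are orthogonal. *)
Lemma euclid_pythagoras r A B D C M :
  distX Euclid r A D = distX Euclid r B C ->
  distX Euclid r A M = distX Euclid r A D / 2 ->
  distX Euclid r M D = distX Euclid r A D / 2 ->
  distX Euclid r B M = distX Euclid r B C / 2 ->
  distX Euclid r M C = distX Euclid r B C / 2 ->
  distX Euclid r A B ^+ 2 + distX Euclid r A C ^+ 2 = distX Euclid r A D ^+ 2.
Proof.
move=> e AM MD BM MC.
have [x1 y1 z1] := euclid_midpoint AM MD.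
have [x2 y2 z2] := euclid_midpoint BM MC.
move/(congr1 (fun x => x ^+ 2)): e; rewrite !euclid_dist_sqr.
have -> : px D = px B + px C - px A by lra.
have -> : py D = py B + py C - py A by lra.
have -> : pz D = pz B + pz C - pz A by lra.
lra.
Qed.

End pythagoras.

Theorem theorem3 (R : realType) (k : model) (r : R) (hr : 0 < r)
  (A B D C : pt R) :
  equiangular_quad k r A B D C ->
  (areaX k r (disk k r A (distX k r A B)) + areaX k r (disk k r A (distX k r A C))
   = areaX k r (disk k r A (distX k r A D)))%E.
Proof.
move=> [[hA hB hD hC]] [[AB AD AC _]] [_] [_] [_] [e [M [hM AM MD BM MC]]].
case: k hA hB hD hC e hM AM MD BM MC => hA hB hD hC e hM AM MD BM MC.
- rewrite !area_euclid_disk ?euclid_dist_gt0// -ge0_muleDl ?lee_fin ?sqr_ge0//.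
  by rewrite -EFinD (euclid_pythagoras e AM MD BM MC).
(* [distX] unfolds to [r * acos (inner A P / r ^+ 2)], so the cap formula applies with this quotient
   as [t]. *)
- have cap P : onX Sphere r P ->
      areaX Sphere r (disk Sphere r A (distX Sphere r A P)) =
      (2 * pi * (r ^+ 2 - inner Sphere A P))%:E.
    move=> hP; rewrite area_sphere_cap//; last exact: dot_sphere.
    by congr (_%:E); rewrite /inner; field; rewrite gt_eqF.
  rewrite !cap// -EFinD; congr (_%:E).
  have := sphere_pythagoras hr hA hB hD hC hM e AM MD BM MC.
  by move=> /(canRL (addrK _)) ->; ring.
- have cap P : onX Hyper r P ->
      areaX Hyper r (disk Hyper r A (distX Hyper r A P)) =
      (2 * pi * (inner Hyper A P - r ^+ 2))%:E.
    move=> hP; rewrite area_hyper_cap//; last by case: hA hP => [? ?] [? ?]; exact: dot_hyper.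
    by congr (_%:E); rewrite /inner; field; rewrite gt_eqF.
  rewrite !cap// -EFinD; congr (_%:E).
  have := hyper_pythagoras hr hA hB hD hC hM e AM MD BM MC.
  by move=> /(canRL (addrK _)) ->; ring.
Qed.
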